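(* Let $R,S$ be rings and $M$ an $(R,S)$-bimodule. Then $S$ is $M$-separable over $R$ if and only if $S$ is $M$-semiseparable over $R$ and $M_S$ is a generator (in the category $\mathrm{Mod}\text{-}S$ of right $S$-modules).
   Context: Rings are unital and associative. $M^*=\mathrm{Hom}_S(M,S)$ (right $S$-linear maps) is an $(S,R)$-bimodule via $(sfr)(m)=sf(rm)$. For an $S$-bimodule $X$, $X^S=\{x\in X\mid sx=xs\ \forall s\in S\}$. $S$ is $M$-separable over $R$ if the evaluation map $\mathrm{ev}_M:M^*\otimes_RM\to S$, $f\otimes_Rm\mapsto f(m)$, is a split epimorphism of $S$-bimodules, i.e. there is $\sum_if_i\otimes_Rm_i\in(M^*\otimes_RM)^S$ with $\sum_if_i(m_i)=1_S$. $S$ is $M$-semiseparable over $R$ if there is $\sum_if_i\otimes_Rm_i\in(M^*\otimes_RM)^S$ such that $\sum_imf_i(m_i)=m$ for every $m\in M$. An object $\mathfrak{G}$ of a category is a generator if for all $f\neq g:X\to Y$ there is $p:\mathfrak{G}\to X$ with $f\circ p\neq g\circ p$. *)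

(* Defs.v *)
From HB Require Import structures.
From mathcomp Require Import all_boot all_algebra.
From mathcomp Require Import boolp freeg.

Set Implicit Arguments.
Unset Strict Implicit.
Unset Printing Implicit Defensive.

Import GRing.Theory.
Local Open Scope ring_scope.
Local Open Scope quotient_scope.

Reserved Notation "m :*: s" (at level 40, left associativity).
Reserved Notation "n ⊗ m" (at level 40, left associativity).

(** Right modules over [S] are left modules over the converse ring [S^c]. *)
Notation rmodType S := (lmodType S^c).

HB.mixin Record Lmodule_isBimodule (R S : pzRingType) M of GRing.Lmodule R M := {
  rscale : M -> S -> M;
  rscaleA : forall m s t, rscale (rscale m s) t = rscale m (s * t);
  rscale1 : forall m, rscale m 1 = m;
  rscaleDl : forall m n s, rscale (m + n) s = rscale m s + rscale n s;
  rscaleDr : forall m s t, rscale m (s + t) = rscale m s + rscale m t;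
  scale_rscale : forall (r : R) m s, rscale (r *: m) s = r *: rscale m s
}.

#[short(type="bimodType")]
HB.structure Definition Bimodule (R S : pzRingType) :=
  {M of GRing.Lmodule R M & Lmodule_isBimodule R S M}.

Notation "m :*: s" := (rscale m s) : ring_scope.

Section BimoduleTheory.
Variables (R S : pzRingType) (M : bimodType R S).

Lemma rscale0l (s : S) : 0 :*: s = 0 :> M.
Proof. by apply: (addrI (0 :*: s)); rewrite -rscaleDl !addr0. Qed.

Lemma rscaleBl (m n : M) (s : S) : (m - n) :*: s = m :*: s - n :*: s.
Proof. by apply/eqP; rewrite eq_sym subr_eq -rscaleDl subrK. Qed.

End BimoduleTheory.

(** The regular S-bimodule, carried by [S^o]. *)
Section RegularBimodule.
Variable S : pzRingType.

Let act (x : S^o) (s : S) : S^o := (x : S) * s.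

Fact regular_rscaleA m s t : act (act m s) t = act m (s * t).
Proof. by rewrite /act mulrA. Qed.
Fact regular_rscale1 m : act m 1 = m.
Proof. exact: mulr1. Qed.
Fact regular_rscaleDl m n s : act (m + n) s = act m s + act n s.
Proof. exact: mulrDl. Qed.
Fact regular_rscaleDr m s t : act m (s + t) = act m s + act m t.
Proof. exact: mulrDr. Qed.
Fact regular_scale_rscale (r : S) m s : act (r *: m) s = r *: act m s.
Proof. by rewrite /act /GRing.scale /= mulrA. Qed.

HB.instance Definition _ := Lmodule_isBimodule.Build S S S^o
  regular_rscaleA regular_rscale1 regular_rscaleDl regular_rscaleDr
  regular_scale_rscale.

Lemma regular_rscaleE (x : S^o) (s : S) : x :*: s = x * s :> S.
Proof. by []. Qed.

End RegularBimodule.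

(** [rmod M] is M_S, the right S-module underlying an (R, S)-bimodule M. *)
Definition rmod (R S : pzRingType) (M : bimodType R S) : Type := M.

Section RightModule.
Variables (R S : pzRingType) (M : bimodType R S).

HB.instance Definition _ := GRing.Zmodule.on (rmod M).

Let rmod_scale (s : S^c) (m : rmod M) : rmod M := (m : M) :*: (s : S).

Fact rmod_scalerA a b v :
  rmod_scale a (rmod_scale b v) = rmod_scale (a * b) v.
Proof. exact: rscaleA. Qed.
Fact rmod_scale1r : left_id 1 rmod_scale.
Proof. exact: rscale1. Qed.
Fact rmod_scalerDr : right_distributive rmod_scale +%R.
Proof. by move=> s m n; apply: rscaleDl. Qed.
Fact rmod_scalerDl v : {morph rmod_scale^~ v : a b / a + b}.
Proof. by move=> s t; apply: rscaleDr. Qed.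

HB.instance Definition _ := GRing.Zmodule_isLmodule.Build S^c (rmod M)
  rmod_scalerA rmod_scale1r rmod_scalerDr rmod_scalerDl.

Lemma rmod_scaleE (s : S^c) (m : rmod M) : s *: m = (m : M) :*: (s : S).
Proof. by []. Qed.

End RightModule.

(** The dual M^* = Hom_S(M_S, S_S), as an (S, R)-bimodule. *)

Definition bdual (R S : pzRingType) (M : bimodType R S) : Type :=
  {linear rmod M -> rmod S^o}.

Section DualFun.
Variables (R S : pzRingType) (M : bimodType R S).

Definition bdual_fun (f : bdual M) (m : M) : S :=
  (f : {linear rmod M -> rmod S^o}) m.
Coercion bdual_fun : bdual >-> Funclass.

Lemma bdualD (f : bdual M) m n : f (m + n) = f m + f n.
Proof. exact: (raddfD (f : {linear rmod M -> rmod S^o})). Qed.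

Lemma bdualM (f : bdual M) m s : f (m :*: s) = f m * s.
Proof. exact: (linearZ_LR (f : {linear rmod M -> rmod S^o}) (s : S^c)). Qed.

Lemma bdualP (f g : bdual M) : (forall m, f m = g m) -> f = g.
Proof.
case: f g => [f [[af] [sf]]] [g [[ag] [sg]]]; rewrite /bdual_fun /= => eq_fg.
have {}eq_fg : f = g by apply/funext.
case: g / eq_fg in ag sg *.
by rewrite (Prop_irrelevance af ag) (Prop_irrelevance sf sg).
Qed.

Section Make.
Variable f : M -> S.
Hypothesis fD : forall m n, f (m + n) = f m + f n.
Hypothesis fM : forall m s, f (m :*: s) = f m * s.

Let g : rmod M -> rmod S^o := f.

Fact mk_bdual_subproof : linear g.
Proof. by move=> s m n; rewrite /g fD (fM m s). Qed.

Definition mk_bdual : bdual M :=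
  HB.pack_for {linear rmod M -> rmod S^o} g
    (GRing.isLinear.Build S^c (rmod M) (rmod S^o) *:%R g mk_bdual_subproof).

Lemma mk_bdualE m : mk_bdual m = f m. Proof. by []. Qed.
End Make.

HB.instance Definition _ := gen_eqMixin (bdual M).
HB.instance Definition _ := gen_choiceMixin (bdual M).

End DualFun.

Section DualBimodule.
Variables (R S : pzRingType) (M : bimodType R S).
Implicit Types (f g h : bdual M) (m n : M) (r : R) (s : S).

Fact bdual_zeroD m n : (0 : S) = 0 + 0. Proof. by rewrite addr0. Qed.
Fact bdual_zeroM m s : (0 : S) = 0 * s. Proof. by rewrite mul0r. Qed.
Definition bdual_zero : bdual M := mk_bdual bdual_zeroD bdual_zeroM.

Fact bdual_oppD f m n : - f (m + n) = - f m + - f n.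
Proof. by rewrite bdualD opprD. Qed.
Fact bdual_oppM f m s : - f (m :*: s) = - f m * s.
Proof. by rewrite bdualM mulNr. Qed.
Definition bdual_opp f : bdual M := mk_bdual (bdual_oppD f) (bdual_oppM f).

Fact bdual_addD f g m n : f (m + n) + g (m + n) = f m + g m + (f n + g n).
Proof. by rewrite !bdualD addrACA. Qed.
Fact bdual_addM f g m s : f (m :*: s) + g (m :*: s) = (f m + g m) * s.
Proof. by rewrite !bdualM mulrDl. Qed.
Definition bdual_add f g : bdual M :=
  mk_bdual (bdual_addD f g) (bdual_addM f g).

Fact bdual_addA : associative bdual_add.
Proof. by move=> f g h; apply: bdualP => m; apply: addrA. Qed.
Fact bdual_addC : commutative bdual_add.
Proof. by move=> f g; apply: bdualP => m; apply: addrC. Qed.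
Fact bdual_add0 : left_id bdual_zero bdual_add.
Proof. by move=> f; apply: bdualP => m; apply: add0r. Qed.
Fact bdual_addN : left_inverse bdual_zero bdual_opp bdual_add.
Proof. by move=> f; apply: bdualP => m; apply: addNr. Qed.

HB.instance Definition _ := GRing.isZmodule.Build (bdual M)
  bdual_addA bdual_addC bdual_add0 bdual_addN.

(** (s f)(m) = s f(m) *)
Fact bdual_scaleD s f m n : s * f (m + n) = s * f m + s * f n.
Proof. by rewrite bdualD mulrDr. Qed.
Fact bdual_scaleM s f m t : s * f (m :*: t) = s * f m * t.
Proof. by rewrite bdualM mulrA. Qed.
Definition bdual_scale s f : bdual M :=
  mk_bdual (bdual_scaleD s f) (bdual_scaleM s f).

Fact bdual_scalerA s t f :
  bdual_scale s (bdual_scale t f) = bdual_scale (s * t) f.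
Proof. by apply: bdualP => m; apply: mulrA. Qed.
Fact bdual_scale1r : left_id 1 bdual_scale.
Proof. by move=> f; apply: bdualP => m; apply: mul1r. Qed.
Fact bdual_scalerDr : right_distributive bdual_scale +%R.
Proof. by move=> s f g; apply: bdualP => m; apply: mulrDr. Qed.
Fact bdual_scalerDl f : {morph bdual_scale^~ f : s t / s + t}.
Proof. by move=> s t; apply: bdualP => m; apply: mulrDl. Qed.

HB.instance Definition _ := GRing.Zmodule_isLmodule.Build S (bdual M)
  bdual_scalerA bdual_scale1r bdual_scalerDr bdual_scalerDl.

(** (f r)(m) = f(r m) *)
Fact bdual_rscale_funD f r m n : f (r *: (m + n)) = f (r *: m) + f (r *: n).
Proof. by rewrite scalerDr bdualD. Qed.
Fact bdual_rscale_funM f r m s : f (r *: (m :*: s)) = f (r *: m) * s.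
Proof. by rewrite -scale_rscale bdualM. Qed.
Definition bdual_rscale f r : bdual M :=
  mk_bdual (bdual_rscale_funD f r) (bdual_rscale_funM f r).

Fact bdual_rscaleA f r t :
  bdual_rscale (bdual_rscale f r) t = bdual_rscale f (r * t).
Proof. by apply: bdualP => m; rewrite !mk_bdualE scalerA. Qed.
Fact bdual_rscale1 f : bdual_rscale f 1 = f.
Proof. by apply: bdualP => m; rewrite !mk_bdualE scale1r. Qed.
Fact bdual_rscaleDl f g r :
  bdual_rscale (f + g) r = bdual_rscale f r + bdual_rscale g r.
Proof. by apply: bdualP. Qed.
Fact bdual_rscaleDr f r t :
  bdual_rscale f (r + t) = bdual_rscale f r + bdual_rscale f t.
Proof. by apply: bdualP => m; rewrite !mk_bdualE scalerDl bdualD. Qed.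
Fact bdual_scale_rscale s f r :
  bdual_rscale (s *: f) r = s *: bdual_rscale f r.
Proof. by apply: bdualP. Qed.

HB.instance Definition _ := Lmodule_isBimodule.Build S R (bdual M)
  bdual_rscaleA bdual_rscale1 bdual_rscaleDl bdual_rscaleDr
  bdual_scale_rscale.

Lemma bdual_addE f g m : (f + g) m = f m + g m. Proof. by []. Qed.
Lemma bdual_scaleE s f m : (s *: f) m = s * f m. Proof. by []. Qed.
Lemma bdual_rscaleE f r m : (f :*: r) m = f (r *: m). Proof. by []. Qed.

End DualBimodule.

(** The tensor product N ⊗_R M of an (S, R)-bimodule N and an (R, T)-bimodule
    M is the quotient of the free abelian group on the pairs (n, m) by the
    subgroup generated by the usual relators; it is an (S, T)-bimodule. *)

Section Tensor.
Variables (S R T : pzRingType) (N : bimodType S R) (M : bimodType R T).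

Let F : zmodType := {freeg (N * M)%type}.
Let gen (n : N) (m : M) : F := << (n, m) >>.

Inductive tensor_rel : F -> Prop :=
| Tensor_rel0 : tensor_rel 0
| Tensor_relB x y : tensor_rel x -> tensor_rel y -> tensor_rel (x - y)
| Tensor_relDl n1 n2 m : tensor_rel (gen (n1 + n2) m - gen n1 m - gen n2 m)
| Tensor_relDr n m1 m2 : tensor_rel (gen n (m1 + m2) - gen n m1 - gen n m2)
| Tensor_relZ n r m : tensor_rel (gen (n :*: r) m - gen n (r *: m)).

Definition tensor_pred : {pred F} := fun x => `[< tensor_rel x >].

Fact tensor_pred_zmod_closed : zmod_closed tensor_pred.
Proof.
split=> [|x y /asboolP rx /asboolP ry]; apply/asboolP; first exact: Tensor_rel0.
exact: Tensor_relB.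
Qed.
HB.instance Definition _ :=
  GRing.isZmodClosed.Build F tensor_pred tensor_pred_zmod_closed.

Definition tensor : Type := Quotient.quot tensor_pred.
HB.instance Definition _ := GRing.Zmodule.on tensor.

Definition tens (n : N) (m : M) : tensor :=
  \pi_(Quotient.quot tensor_pred) (gen n m).
Local Notation "n ⊗ m" := (tens n m) : ring_scope.

Let eq_tensor (x y : F) : tensor_rel (x - y) ->
  \pi_(Quotient.quot tensor_pred) x = \pi_(Quotient.quot tensor_pred) y.
Proof.
by move=> rxy; apply/eqP; rewrite -Quotient.idealrBE; apply/asboolP.
Qed.

Lemma tensDl n1 n2 m : (n1 + n2) ⊗ m = n1 ⊗ m + n2 ⊗ m.
Proof.
rewrite /tens -[RHS]raddfD; apply: eq_tensor.
by rewrite opprD addrA; apply: Tensor_relDl.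
Qed.

Lemma tensNl n m : (- n) ⊗ m = - (n ⊗ m).
Proof.
have t0 : 0 ⊗ m = 0 by apply: (addrI (0 ⊗ m)); rewrite -tensDl !addr0.
by apply/eqP; rewrite -addr_eq0 -tensDl addNr t0.
Qed.

Lemma tensDr n m1 m2 : n ⊗ (m1 + m2) = n ⊗ m1 + n ⊗ m2.
Proof.
rewrite /tens -[RHS]raddfD; apply: eq_tensor.
by rewrite opprD addrA; apply: Tensor_relDr.
Qed.

Lemma tensZ n r m : (n :*: r) ⊗ m = n ⊗ (r *: m).
Proof. exact/eq_tensor/Tensor_relZ. Qed.

Lemma tens_ind (P : tensor -> Prop) : P 0 ->
  (forall x y, P x -> P y -> P (x - y)) -> (forall n m, P (n ⊗ m)) ->
  forall x, P x.
Proof.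
move=> P0 PB Pt x; rewrite -[x]reprK.
have PN y : P y -> P (- y) by move=> Py; rewrite -sub0r; apply: PB.
have PD y z : P y -> P z -> P (y + z).
  by move=> Py Pz; rewrite -[z]opprK; apply/PB/PN.
rewrite -[repr x]freeg_sumE raddf_sum; apply: big_ind => // -[n m] _.
rewrite -[coeff _ _]intz -freegU_mulz raddfMz -/(n ⊗ m).
have Pn k : P (n ⊗ m *+ k).
  by elim: k => [|k IHk]; rewrite ?mulr0n // mulrS; apply: PD.
by case: (coeff _ _) => k; [apply: Pn | apply/PN/Pn].
Qed.

Lemma tensor_sum (x : tensor) :
  exists l : seq (N * M), x = \sum_(p <- l) p.1 ⊗ p.2.
Proof.
elim/tens_ind: x => [|x y [l1 ->] [l2 ->]|n m].
- by exists [::]; rewrite big_nil.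
- exists (l1 ++ [seq (- p.1, p.2) | p <- l2]).
  rewrite big_cat big_map -sumrN; congr (_ + _); apply: eq_bigr => p _ /=.
  by rewrite tensNl.
- by exists [:: (n, m)]; rewrite big_seq1.
Qed.

Record balanced (A : zmodType) (phi : N -> M -> A) : Prop := Balanced {
  balancedDl : forall n1 n2 m, phi (n1 + n2) m = phi n1 m + phi n2 m;
  balancedDr : forall n m1 m2, phi n (m1 + m2) = phi n m1 + phi n m2;
  balancedZ : forall n r m, phi (n :*: r) m = phi n (r *: m)
}.

Section Lift.
Variables (A : zmodType) (phi : N -> M -> A).

Let flift : F -> A := fglift (fun p : N * M => phi p.1 p.2 : zmodule A).

Definition tensor_lift (x : tensor) : A :=
  flift (repr (x : Quotient.quot tensor_pred)).

Hypothesis phiP : balanced phi.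

Let fliftB : zmod_morphism flift.
Proof. exact: (@lift_is_additive int (N * M)%type (zmodule A)). Qed.

Let flift_gen n m : flift (gen n m) = phi n m.
Proof. by rewrite /flift liftU scale1r. Qed.

Let flift_rel x : tensor_rel x -> flift x = 0.
Proof.
elim=> [|y z _ y0 _ z0|n1 n2 m|n m1 m2|n r m].
- by rewrite -{1}(subrr 0) fliftB subrr.
- by rewrite fliftB y0 z0 subrr.
- by rewrite !fliftB !flift_gen (balancedDl phiP) addrAC addrK subrr.
- by rewrite !fliftB !flift_gen (balancedDr phiP) addrAC addrK subrr.
- by rewrite !fliftB !flift_gen (balancedZ phiP) subrr.
Qed.

Let tensor_lift_pi x :
  tensor_lift (\pi_(Quotient.quot tensor_pred) x) = flift x.
Proof.
apply/eqP; rewrite -subr_eq0 -fliftB flift_rel //.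
have : repr (\pi_(Quotient.quot tensor_pred) x) - x \in tensor_pred.
  by rewrite Quotient.idealrBE reprK.
by move/asboolP.
Qed.

Lemma tensor_liftE n m : tensor_lift (n ⊗ m) = phi n m.
Proof. by rewrite tensor_lift_pi flift_gen. Qed.

Lemma tensor_liftB x y :
  tensor_lift (x - y) = tensor_lift x - tensor_lift y.
Proof.
rewrite -[x]reprK -[y]reprK -[X in tensor_lift X]raddfB !tensor_lift_pi.
exact: fliftB.
Qed.

Lemma tensor_lift0 : tensor_lift 0 = 0.
Proof. by rewrite -[0 : tensor](subrr 0) tensor_liftB subrr. Qed.

Lemma tensor_liftD x y :
  tensor_lift (x + y) = tensor_lift x + tensor_lift y.
Proof.
have liftN : tensor_lift (- y) = - tensor_lift y.
  by rewrite -[- y]sub0r tensor_liftB tensor_lift0 sub0r.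
by rewrite -{1}[y]opprK tensor_liftB liftN opprK.
Qed.

End Lift.

(** s (n ⊗ m) = (s n) ⊗ m *)
Definition tensor_scale (s : S) : tensor -> tensor :=
  tensor_lift (fun n m => (s *: n) ⊗ m).

(** (n ⊗ m) t = n ⊗ (m t) *)
Definition tensor_rscale (x : tensor) (t : T) : tensor :=
  tensor_lift (fun n m => n ⊗ (m :*: t)) x.

Fact tensor_scale_balanced s : balanced (fun n m => (s *: n) ⊗ m).
Proof.
split=> [n1 n2 m|n m1 m2|n r m].
- by rewrite scalerDr tensDl.
- by rewrite tensDr.
- by rewrite -scale_rscale tensZ.
Qed.

Fact tensor_rscale_balanced t : balanced (fun n m => n ⊗ (m :*: t)).
Proof.
split=> [n1 n2 m|n m1 m2|n r m].
- by rewrite tensDl.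
- by rewrite rscaleDl tensDr.
- by rewrite tensZ scale_rscale.
Qed.

Let lB s := tensor_liftB (tensor_scale_balanced s).
Let rB t := tensor_liftB (tensor_rscale_balanced t).
Let l0 s := tensor_lift0 (tensor_scale_balanced s).
Let r0 t := tensor_lift0 (tensor_rscale_balanced t).
Let lE s := tensor_liftE (tensor_scale_balanced s).
Let rE t := tensor_liftE (tensor_rscale_balanced t).
Let lD s := tensor_liftD (tensor_scale_balanced s).
Let rD t := tensor_liftD (tensor_rscale_balanced t).

Fact tensor_scalerA s1 s2 x :
  tensor_scale s1 (tensor_scale s2 x) = tensor_scale (s1 * s2) x.
Proof.
elim/tens_ind: x => [|x y IHx IHy|n m]; rewrite /tensor_scale ?l0 ?addr0 //.
  by rewrite !lB -![tensor_lift _ _]/(tensor_scale _ _) IHx IHy ?opprD 1?addrACA.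
by rewrite !lE scalerA.
Qed.
Fact tensor_scale1r : left_id 1 tensor_scale.
Proof.
move=> x; elim/tens_ind: x => [|x y IHx IHy|n m]; rewrite /tensor_scale ?l0 ?addr0 //.
  by rewrite !lB -![tensor_lift _ _]/(tensor_scale _ _) IHx IHy ?opprD 1?addrACA.
by rewrite lE scale1r.
Qed.
Fact tensor_scalerDr : right_distributive tensor_scale +%R.
Proof. by move=> s x y; apply: lD. Qed.
Fact tensor_scalerDl x : {morph tensor_scale^~ x : s t / s + t}.
Proof.
move=> s t; elim/tens_ind: x => [|x y IHx IHy|n m]; rewrite /tensor_scale ?l0 ?addr0 //.
  by rewrite !lB -![tensor_lift _ _]/(tensor_scale _ _) IHx IHy ?opprD 1?addrACA.
by rewrite !lE scalerDl tensDl.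
Qed.

HB.instance Definition _ := GRing.Zmodule_isLmodule.Build S tensor
  tensor_scalerA tensor_scale1r tensor_scalerDr tensor_scalerDl.

Fact tensor_rscaleA x t1 t2 :
  tensor_rscale (tensor_rscale x t1) t2 = tensor_rscale x (t1 * t2).
Proof.
elim/tens_ind: x => [|x y IHx IHy|n m]; rewrite /tensor_rscale ?r0 ?addr0 //.
  by rewrite !rB -![tensor_lift _ _]/(tensor_rscale _ _) IHx IHy ?opprD 1?addrACA.
by rewrite !rE rscaleA.
Qed.
Fact tensor_rscale1 x : tensor_rscale x 1 = x.
Proof.
elim/tens_ind: x => [|x y IHx IHy|n m]; rewrite /tensor_rscale ?r0 ?addr0 //.
  by rewrite !rB -![tensor_lift _ _]/(tensor_rscale _ _) IHx IHy ?opprD 1?addrACA.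
by rewrite rE rscale1.
Qed.
Fact tensor_rscaleDl x y t :
  tensor_rscale (x + y) t = tensor_rscale x t + tensor_rscale y t.
Proof. exact: rD. Qed.
Fact tensor_rscaleDr x t1 t2 :
  tensor_rscale x (t1 + t2) = tensor_rscale x t1 + tensor_rscale x t2.
Proof.
elim/tens_ind: x => [|x y IHx IHy|n m]; rewrite /tensor_rscale ?r0 ?addr0 //.
  by rewrite !rB -![tensor_lift _ _]/(tensor_rscale _ _) IHx IHy ?opprD 1?addrACA.
by rewrite !rE rscaleDr tensDr.
Qed.
Fact tensor_scale_rscale (s : S) x t :
  tensor_rscale (s *: x) t = s *: tensor_rscale x t.
Proof.
rewrite /tensor_rscale.
elim/tens_ind: x => [|x y IHx IHy|n m]; first by rewrite scaler0 r0 scaler0.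
  by rewrite scalerBr !rB IHx IHy scalerBr.
by rewrite [s *: (n ⊗ m)]lE !rE [RHS]lE.
Qed.

HB.instance Definition _ := Lmodule_isBimodule.Build S T tensor
  tensor_rscaleA tensor_rscale1 tensor_rscaleDl tensor_rscaleDr
  tensor_scale_rscale.

Lemma tens_scaleE (s : S) n m : s *: (n ⊗ m) = (s *: n) ⊗ m.
Proof. exact: lE. Qed.

Lemma tens_rscaleE n m (t : T) : (n ⊗ m) :*: t = n ⊗ (m :*: t).
Proof. exact: rE. Qed.

End Tensor.

Notation "n ⊗ m" := (tens n m) : ring_scope.

(** A morphism of (S, T)-bimodules is an element of [{linear X -> Y}] that is
    moreover [right_linear]. *)
Definition right_linear (S T : pzRingType) (X Y : bimodType S T) (f : X -> Y) :=
  forall x (t : T), f (x :*: t) = f x :*: t.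

Definition bimod_split_epi (S T : pzRingType) (X Y : bimodType S T)
    (f : {linear X -> Y}) : Prop :=
  right_linear f /\
  exists g : {linear Y -> X}, right_linear g /\ forall y, f (g y) = y.

(** X^S *)
Definition bimod_invariant (S : pzRingType) (X : bimodType S S) (x : X) : Prop :=
  forall s : S, s *: x = x :*: s.

(** The evaluation map ev_M : M^* ⊗_R M -> S, a morphism of S-bimodules. *)
Section Evaluation.
Variables (R S : pzRingType) (M : bimodType R S).

Definition ev : tensor (bdual M) M -> S^o :=
  tensor_lift (fun (f : bdual M) (m : M) => f m : S^o).

Fact ev_balanced : balanced (fun (f : bdual M) (m : M) => f m : S^o).
Proof. by split=> // f m1 m2; rewrite bdualD. Qed.

Lemma ev_tens (f : bdual M) m : ev (f ⊗ m) = f m.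
Proof. exact: (tensor_liftE ev_balanced). Qed.

Fact ev_is_linear : linear ev.
Proof.
move=> s x y; rewrite /ev (tensor_liftD ev_balanced); congr (_ + _).
elim/tens_ind: x => [|x z IHx IHz|f m].
- by rewrite scaler0 (tensor_lift0 ev_balanced) scaler0.
- by rewrite scalerBr !(tensor_liftB ev_balanced) IHx IHz scalerBr.
by rewrite tens_scaleE -!/(ev _) !ev_tens.
Qed.
HB.instance Definition _ :=
  GRing.isLinear.Build S (tensor (bdual M) M) S^o *:%R ev ev_is_linear.

Lemma ev_right_linear : right_linear ev.
Proof.
move=> x s; elim/tens_ind: x => [|x y IHx IHy|f m].
- by rewrite rscale0l raddf0 rscale0l.
- by rewrite rscaleBl !raddfB /= IHx IHy rscaleBl.
by rewrite tens_rscaleE !ev_tens bdualM.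
Qed.

End Evaluation.

Definition separable_over (R S : pzRingType) (M : bimodType R S) : Prop :=
  bimod_split_epi (@ev R S M).

Definition semiseparable_over (R S : pzRingType) (M : bimodType R S) : Prop :=
  exists l : seq (bdual M * M),
    bimod_invariant (\sum_(p <- l) p.1 ⊗ p.2) /\
    forall m : M, \sum_(p <- l) m :*: p.1 p.2 = m.

(** Generators of the category of left A-modules; taking A := S^c gives the
    generators of Mod-S. *)
Definition generator (A : pzRingType) (G : lmodType A) : Prop :=
  forall (X Y : lmodType A) (f g : {linear X -> Y}),
    ~ (f =1 g) -> exists p : {linear G -> X}, ~ (f \o p =1 g \o p).

Section SeparableP.
Variables (R S : pzRingType) (M : bimodType R S).

Let act (x : tensor (bdual M) M) (s : S^o) : tensor (bdual M) M := (s : S) *: x.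

Let act_linear x : linear (act x).
Proof. by move=> s t u; rewrite /act scalerDl -scalerA. Qed.

Lemma separable_overP :
  separable_over M <->
  exists l : seq (bdual M * M),
    bimod_invariant (\sum_(p <- l) p.1 ⊗ p.2) /\ \sum_(p <- l) p.1 p.2 = 1.
Proof.
have evE (l : seq (bdual M * M)) :
    ev (\sum_(p <- l) p.1 ⊗ p.2) = \sum_(p <- l) p.1 p.2.
  by rewrite raddf_sum; apply: eq_bigr => p _; rewrite /= ev_tens.
split=> [[_ [g [gM gK]]]|[l [lP l1]]].
  have [l g1] := tensor_sum (g 1); exists l; rewrite -g1 -evE -g1 gK.
  by split=> // s; rewrite -gM -linearZ; congr (g _); rewrite regular_rscaleE
    [LHS]mulr1 mul1r.
split; first exact: ev_right_linear.
set x := \sum_(p <- l) _ in lP.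
pose g : {linear S^o -> tensor (bdual M) M} :=
  HB.pack_for {linear S^o -> tensor (bdual M) M} (act x)
    (GRing.isLinear.Build S S^o (tensor (bdual M) M) *:%R (act x) (act_linear x)).
exists g; split=> [s t|s].
  rewrite /g /= /act regular_rscaleE -scalerA lP.
  by rewrite -scale_rscale.
by rewrite /g /= /act linearZ /= evE l1; apply: mulr1.
Qed.

End SeparableP.

(* Main.v *)
Require Import Defs.
From HB Require Import structures.
From mathcomp Require Import all_boot all_algebra.
From mathcomp Require Import boolp.

Set Implicit Arguments.
Unset Strict Implicit.
Unset Printing Implicit Defensive.

Import GRing.Theory.
Local Open Scope ring_scope.

(** Put [c := \sum_i f_i(m_i)] for an [S]-invariant element of [M^* ⊗ M]. If
    [c = 1], then semiseparability is immediate, and [M_S] is a generator since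
    every [x = \sum_i x f_i(m_i)] lies in the sum of the images of the maps
    [m |-> x f_i(m)]. Conversely [c] is central, and if moreover [m c = m] for
    all [m], then [c p(m) = p(m) c = p(m c) = p(m)] for all [p] in [M^*]; so no
    map [M -> S] distinguishes left multiplication by [c] from the identity. *)

Section Aux.
Variables (R S : pzRingType) (M : bimodType R S).

Lemma rscale_sumr (I : Type) (l : seq I) (a : I -> S) (m : M) :
  \sum_(i <- l) m :*: a i = m :*: \sum_(i <- l) a i.
Proof.
have m0 : m :*: 0 = 0 by apply: (addrI (m :*: 0)); rewrite -rscaleDr !addr0.
exact: esym (big_morph (rscale m) (rscaleDr m) m0 _ _ _).
Qed.

Lemma ev_sum (l : seq (bdual M * M)) :
  ev (\sum_(p <- l) p.1 ⊗ p.2) = \sum_(p <- l) p.1 p.2.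
Proof. by rewrite raddf_sum; apply: eq_bigr => p _; rewrite /= ev_tens. Qed.

(** As a bimodule map, [ev] sends invariants to invariants of [S], that is, to the centre. *)
Lemma ev_invariant_central (x : tensor (bdual M) M) (s : S) :
  bimod_invariant x -> s * ev x = ev x * s.
Proof. by move=> /(_ s) /(congr1 (@ev R S M)); rewrite linearZ ev_right_linear. Qed.

Section DualScale.
Variables (X : rmodType S) (x : X) (h : bdual M).

(** The map [m |-> x h(m)]: the right action on [X] is scaling by [S^c]. *)
Definition dual_scale (m : rmod M) : X := (h m : S^c) *: x.

Fact dual_scale_is_linear : linear dual_scale.
Proof.
by move=> s m n; rewrite /dual_scale bdualD scalerDl rmod_scaleE bdualM scalerA.
Qed.

HB.instance Definition _ := GRing.isLinear.Build S^c (rmod M) X *:%R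
  dual_scale dual_scale_is_linear.

End DualScale.

Lemma generator_of_ev1 (l : seq (bdual M * M)) :
  \sum_(p <- l) p.1 p.2 = 1 -> generator (rmod M : rmodType S).
Proof.
move=> l1 X Y f g; apply: contra_notP => no_p x.
have -> : x = \sum_(p <- l) dual_scale x p.1 p.2.
  by rewrite -scaler_suml [X in X *: x]l1 scale1r.
rewrite !raddf_sum; apply: eq_bigr => -[h m] _ /=.
(* If [f] and [g] differ at [x h(m)], then [dual_scale x h] separates them. *)
by apply: contrapT => neq; apply: no_p; exists (dual_scale x h) => /(_ m).
Qed.

Lemma generator_central_eq1 (c : S) :
  generator (rmod M : rmodType S) -> (forall s, s * c = c * s) ->
  (forall m : M, m :*: c = m) -> c = 1.
Proof.
move=> genM cC Mc.
(* [bdual S^o] is the endomorphisms of [S_S], so [c *: g] is left multiplication by [c]; it differs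
   from [g] at [1]. *)
pose g : bdual S^o := (idfun : {linear rmod S^o -> rmod S^o}).
pose f : bdual S^o := c *: g.
apply: contrapT => c_neq1.
have [|p] := genM _ _ f g; first by move=> /(_ 1); rewrite /= mulr1.
by apply=> m /=; rewrite -cC -[p m * c](bdualM (p : bdual M)) Mc.
Qed.

End Aux.

Theorem corollary3p20 (R S : pzRingType) (M : bimodType R S) :
  separable_over M <->
  semiseparable_over M /\ generator (rmod M : rmodType S).
Proof.
rewrite separable_overP; split=> [[l [lP l1]] | [[l [lP lM]] genM]].
  split; last exact: generator_of_ev1 l1.
  by exists l; split=> // m; rewrite rscale_sumr l1 rscale1.
exists l; split=> //; apply: generator_central_eq1 genM _ _ => [s|m].
  by rewrite -ev_sum; apply: ev_invariant_central.
by rewrite -rscale_sumr.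
Qed.
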